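(* Let $G\in\mathcal{G}$, with cliques on $X=\{x_1,\ldots,x_m\}$ and $Y=\{y_1,\ldots,y_n\}$, where $n>m$ and both $n$ and $m$ are odd, such that $N[x_1]=\{y_2,y_3,\ldots,y_{t+1}\}\cup X$, $N[y_1]=\{x_2,x_3,\ldots,x_{s+1}\}\cup Y$, $N[x_i]=X$ for $s+2\leq i\leq m$, and $N[y_i]=Y$ for $t+2\leq i\leq n$, where $s,t\ge 0$, $s+1\leq m$ and $t+1\leq n-m$. Then $T_2(G)$ is well-covered.
   Context: $\mathcal{G}$ is the class of graphs obtained by taking the disjoint union of a complete graph $K_m$ with vertex set $X=\{x_1,\ldots,x_m\}$ and a complete graph $K_n$ with vertex set $Y=\{y_1,\ldots,y_n\}$, where $n\geq m$, and then adding some (possibly no) edges each joining a vertex of $X$ to a vertex of $Y$. $N[v]$ denotes the closed neighbourhood of $v$ ($v$ together with all its neighbours). The $2$-token graph $T_2(G)$ has as vertices the $2$-subsets of $V(G)$, two of them adjacent if their symmetric difference is an edge of $G$. A graph is well-covered if all of its maximal (with respect to inclusion) independent sets have the same cardinality.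
   Formalization: Added assumption: there is no edge x_i y_j with i, j ≥ 2, so the X–Y edges are exactly x_1y_2,…,x_1y_{t+1} and y_1x_2,…,y_1x_{s+1}; without it the claim fails, e.g. m=3, n=5, s=t=1 with X–Y edges x_1y_2, x_2y_1, x_2y_2. *)

(* Defs.v *)
From HB Require Import structures.
From mathcomp Require Import all_boot.

Set Implicit Arguments.
Unset Strict Implicit.
Unset Printing Implicit Defensive.

Record sgraph := SGraph {
  vertex :> finType;
  edge : rel vertex;
  edge_sym : symmetric edge;
  edge_irrefl : irreflexive edge }.

Arguments edge {s}.

Section Graph.
Variable G : sgraph.

Definition closed_nbhd (v : G) : {set G} := [set u | (u == v) || edge v u].

Definition independent (A : {set G}) : bool :=
  [forall u in A, forall v in A, ~~ edge u v].

Definition well_covered : Prop :=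
  forall A B : {set G},
    maxset independent A -> maxset independent B -> #|A| = #|B|.

(* G is a graph of the class, with cliques on X and Y enumerated by x and y;
   the indices start at 0, so x i and y j stand for x_{i+1} and y_{j+1}. *)
Record two_clique_graph (m n : nat) (x : 'I_m -> G) (y : 'I_n -> G) : Prop := {
  tcg_le : m <= n;
  tcg_injx : injective x;
  tcg_injy : injective y;
  tcg_disjoint : forall i j, x i != y j;
  tcg_cover : forall v, (exists i, v = x i) \/ (exists j, v = y j);
  tcg_cliquex : forall i i', i != i' -> edge (x i) (x i');
  tcg_cliquey : forall j j', j != j' -> edge (y j) (y j') }.

End Graph.

Section TokenGraph.
Variables (k : nat) (G : sgraph).

Definition symdiff (A B : {set G}) : {set G} := (A :\: B) :|: (B :\: A).

Definition token_vertex := {A : {set G} | #|A| == k}.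

Definition token_edge : rel token_vertex := fun A B =>
  [exists u, exists v, edge u v && (symdiff (val A) (val B) == [set u; v])].

Lemma token_edge_sym : symmetric token_edge.
Proof.
by move=> A B; rewrite /token_edge /symdiff [val A :\: val B :|: _]setUC.
Qed.

Lemma token_edge_irrefl : irreflexive token_edge.
Proof.
move=> A; apply/existsP=> -[u /existsP[v /andP[_ /eqP/setP/(_ u)]]].
by rewrite /symdiff setUid setDv !inE eqxx.
Qed.

Definition token_graph : sgraph := SGraph token_edge_sym token_edge_irrefl.

End TokenGraph.

(* Main.v *)
Require Import Defs.
From mathcomp Require Import all_boot zify.

(** An independent set of the 2-token graph is a set of pairs, that is a graph
    [f] on the vertices of [G] in which the neighbours of every vertex are
    independent in [G].  As [G] is covered by the cliques [X] and [Y], [f]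
    induces a matching on [X], a matching on [Y] and a matching between [X]
    and [Y].  If the independent set is maximal, each of the first two misses
    at most two vertices (hence exactly one, by parity), because among three
    missed vertices some two can be joined; and the third one covers [X],
    because a vertex of [X] that it misses conflicts with at most
    [maxn 1 t + 1] vertices of [Y], while at least [n - m + 1] are free.  So
    the set of pairs has [(m - 1) / 2 + (n - 1) / 2 + m] elements. *)

Set Implicit Arguments.
Unset Strict Implicit.
Unset Printing Implicit Defensive.

(** * Parity and counting preliminaries *)

(** Peeling off a vertex [a] removes its row and its column, equal by symmetry, and a zero diagonal
    entry. Hence an odd clique has an odd number of unpaired vertices. *)
Lemma odd_sum_symmetric (T : finType) (f : rel T) (A : {set T}) :
  symmetric f -> irreflexive f ->
  odd (\sum_(u in A) \sum_(v in A) f u v) = false.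
Proof.
move=> fC fI; have [k] := ubnP #|A|; elim: k A => // k IHk A.
have [->|[a aA]] := set_0Vmem A; first by rewrite big_set0.
rewrite (cardsD1 a) aA ltnS => /IHk oddA.
rewrite (big_setD1 a aA) /=; under [X in _ + X]eq_bigr => u _ do
  rewrite (big_setD1 a aA) /=.
rewrite (big_setD1 a aA) /= fI add0n big_split /= !oddD oddA addbF.
by under [X in _ (+) odd X]eq_bigr => u _ do rewrite fC; rewrite addbb.
Qed.

Lemma card_ord_range (n t : nat) : #|[set j : 'I_n | 1 <= j <= t]| <= t.
Proof.
case: n => [|n]; first by rewrite (leq_trans (max_card _)) ?card_ord.
have sub : [set j : 'I_n.+1 | 1 <= j <= t] \subset
    [set inord k.+1 | k : 'I_t].
  apply/subsetP => j; rewrite inE => /andP[j0 jt].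
  have jt' : j.-1 < t by lia.
  by apply/imsetP; exists (Ordinal jt') => //; apply: val_inj;
    rewrite /= prednK // inordK.
by apply: leq_trans (subset_leq_card sub) _;
  rewrite (leq_trans (leq_imset_card _ _)) ?card_ord.
Qed.

(** * Maximal sets of pairs in a graph covered by two cliques *)

(** Independent sets of the 2-token graph, seen as relations: [{a, b}] and [{a, c}] are adjacent
    when [e b c]. The witness [c] in [pairing_max] is a pair of [f] that blocks the addition of
    [{a, b}]. *)
Record maximal_pairing (V : finType) (e f : rel V) : Prop := {
  pairing_sym : symmetric f;
  pairing_irrefl : irreflexive f;
  pairing_indep : forall a b c, f a b -> f a c -> ~~ e b c;
  pairing_max : forall a b, a != b -> ~~ f a b ->
    exists c, f a c && e b c || f b c && e a c }.

(** All that is kept of the cross edges is that each meets one of two nonadjacent hubs. No sizes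
    enter, so the two sides can be exchanged. *)
Record two_cliques (V : finType) (e : rel V) (X Y : {set V}) (x1 y1 : V) :
    Prop := {
  cliques_cover : forall v, (v \in Y) = (v \notin X);
  cliques_left : forall u v, u \in X -> v \in X -> u != v -> e u v;
  cliques_right : forall u v, u \in Y -> v \in Y -> u != v -> e u v;
  cliques_hub_left : x1 \in X;
  cliques_hub_right : y1 \in Y;
  cliques_hubs : ~~ e x1 y1;
  cliques_cross : forall u v, u \in X -> v \in Y -> e u v ->
    (u == x1) || (v == y1) }.

Lemma two_cliques_sym (V : finType) (e : rel V) (X Y : {set V}) (x1 y1 : V) :
  symmetric e -> two_cliques e X Y x1 y1 -> two_cliques e Y X y1 x1.
Proof.
move=> eC [cov cX cY hX hY hub cross]; split=> //.
- by move=> v; rewrite cov negbK.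
- by rewrite eC.
- by move=> u v uY vX; rewrite eC orbC; apply: cross.
Qed.

Definition unpaired (V : finType) (f : rel V) (X : {set V}) : {set V} :=
  [set u in X | [forall v in X, ~~ f u v]].

(** Two partners in one clique would be adjacent, against [pairing_indep]. As [u] is arbitrary, this
    gives the matchings inside each clique and the one between them. *)
Lemma pairing_uniq (V : finType) (e f : rel V) (A : {set V}) (u v w : V) :
  maximal_pairing e f -> {in A &, forall a b, a != b -> e a b} ->
  v \in A -> w \in A -> f u v -> f u w -> v = w.
Proof.
move=> [_ _ fi _] cA vA wA fuv fuw; apply/eqP; apply/negPn/negP => /(cA _ _ vA wA).
by apply/negP; apply: fi fuv fuw.
Qed.

Lemma sum_pairing (V : finType) (e f : rel V) (A : {set V}) (u : V) :
  maximal_pairing e f -> {in A &, forall a b, a != b -> e a b} ->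
  \sum_(v in A) f u v = [exists v in A, f u v].
Proof.
move=> fP cA; case: existsP => [[v /andP[vA fuv]]|noV].
  rewrite (big_setD1 v vA) /= fuv big1 // => w; rewrite !inE => /andP[wv wA].
  apply/eqP; rewrite eqb0; apply: contra wv => fuw.
  by rewrite (pairing_uniq fP cA wA vA fuw fuv).
rewrite big1 // => v vA; apply/eqP; rewrite eqb0.
by apply/negP => fuv; apply: noV; exists v; rewrite vA.
Qed.

Lemma sum_pairing_unpaired (V : finType) (e f : rel V) (A : {set V}) :
  maximal_pairing e f -> {in A &, forall a b, a != b -> e a b} ->
  \sum_(u in A) \sum_(v in A) f u v + #|unpaired f A| = #|A|.
Proof.
move=> fP cA; under eq_bigr => u _ do rewrite (sum_pairing _ fP cA).
rewrite -[#|unpaired _ _|]sum1_card -[#|A|]sum1_card.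
under [X in _ + X]eq_bigl => u do rewrite inE.
rewrite big_mkcondr -big_split /=; apply: eq_bigr => u _.
by rewrite -[in X in _ + X]negb_exists_in; case: ifP => [/negbTE->|/negbFE->].
Qed.

Section MaximalPairing.

Variables (V : finType) (e f : rel V) (X Y : {set V}) (x1 y1 : V).
Hypotheses (eC : symmetric e) (fP : maximal_pairing e f).

(** Two unpaired vertices can only be blocked by some [c] in [Y], paired with one and adjacent to
    the other. If neither is [x1], the cross edge forces [c = y1]; so three unpaired vertices are
    absurd once two of them avoid [x1] and are not paired with [y1]. *)
Lemma card_unpaired_le2 (cP : two_cliques e X Y x1 y1) :
  #|unpaired f X| <= 2.
Proof.
have [fC fI fi fm] := fP; have [cov cX cY hX hY hub cross] := cP.
set U := unpaired f X; rewrite leqNgt; apply/negP => U3.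
have UX u : u \in U -> u \in X by rewrite inE => /andP[].
have Uf u c : u \in U -> f u c -> c \in Y.
  rewrite inE => /andP[uX /forall_inP fu] fuc.
  by rewrite cov; apply: contraL fuc; apply: fu.
have joinU a b : a \in U -> b \in U -> a != b ->
    exists2 c, c \in Y & f a c && e b c || f b c && e a c.
  move=> aU bU ab; have [|c cab] := fm a b ab.
    by move: aU; rewrite inE => /andP[_ /forall_inP]; apply; apply: UX.
  by exists c => //; case/orP: cab => /andP[fc _]; [apply: Uf aU fc|apply: Uf bU fc].
(* Whatever blocks [{x1, u}] would give [y1] two partners in [X] or make it adjacent to [x1]. *)
have hubU u : x1 \in U -> u \in U -> u != x1 -> ~~ f u y1.
  move=> x1U uU ux1; apply/negP => fuy.
  have [|c cY' /orP[/andP[fc ec]|/andP[fc ec]]] := joinU x1 u x1U uU.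
  - by rewrite eq_sym.
  - have := cross _ _ (UX _ uU) cY' ec; rewrite (negbTE ux1) /= => /eqP cy.
    move: fc fuy; rewrite cy fC => fx; rewrite fC => fu.
    by move: ux1; rewrite (pairing_uniq fP cX (UX _ uU) hX fu fx) eqxx.
  - have cy := pairing_uniq fP cY cY' hY fc fuy.
    by move: hub; rewrite -cy ec.
have [a [b [aU bU ab [ax bx fa fb]]]] : exists a b, [/\ a \in U, b \in U, a != b &
    [/\ a != x1, b != x1, ~~ f a y1 & ~~ f b y1]].
  have [x1U|x1U] := boolP (x1 \in U).
    have /card_gt1P[a [b []]] : 1 < #|U :\ x1|.
      by move: U3; rewrite (cardsD1 x1) x1U.
    rewrite !in_setD1 => /andP[ax aU] /andP[bx bU] ab.
    by exists a, b; split=> //; split=> //; apply: hubU.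
  (* When [x1] is not in [U], it suffices to discard the at most one partner of [y1]. *)
  pose Z := [set u in U | f u y1].
  have Z1 : #|Z| <= 1.
    apply/card_le1_eqP => u v; rewrite !(in_set (fun u => (u \in U) && _)).
    rewrite ![f _ y1]fC => /andP[/UX uX fu] /andP[/UX vX fv].
    exact: (pairing_uniq fP cX vX uX fv fu).
  have /card_gt1P[a [b []]] : 1 < #|U :\: Z|.
    by have := cardsID Z U; have := subset_leq_card (subsetIr U Z); lia.
  rewrite !in_setD !(in_set (fun u => (u \in U) && _)).
  move=> /andP[fa aU] /andP[fb bU] ab.
  exists a, b; split=> //; move: fa fb; rewrite aU bU /= => -> ->.
  by split=> //; apply: contraNneq x1U => <-.
have [c cY' /orP[/andP[fc ec]|/andP[fc ec]]] := joinU a b aU bU ab.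
  have := cross _ _ (UX _ bU) cY' ec; rewrite (negbTE bx) => /eqP cy.
  by move: fa; rewrite -cy fc.
have := cross _ _ (UX _ aU) cY' ec; rewrite (negbTE ax) => /eqP cy.
by move: fb; rewrite -cy fc.
Qed.

(** If [u] had no partner in [Y], each pair [{u, v}] with [v] free would be blocked. Blocked
    vertices lie in a union of two sets of total size at most [maxn 1 t + 1], too few for the free
    ones. *)
Lemma pairing_cross_exists (t : nat) (u : V) (cP : two_cliques e X Y x1 y1) :
  #|[set v in Y | e x1 v]| <= t ->
  t < #|Y| - #|X| -> 1 < #|Y| - #|X| -> u \in X ->
  [exists v in Y, f u v].
Proof.
have [fC fI fi fm] := fP; have [cov cX cY hX hY hub cross] := cP.
move=> card_t tn n1 uX; apply: contraT => /exists_inPn noV; exfalso.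
pose free := [set v in Y | [forall w in X, ~~ f w v]].
(* Strict, because the vertices of [Y] that are not free inject into [X :\ u]. *)
have card_free : #|Y| - #|X| < #|free|.
  have cu : #|Y :\: free| <= #|X :\ u|.
    (* The default [x1] is never reached on [Y :\: free]. *)
    pose g v := odflt x1 [pick w in X | f w v].
    have gP v : v \in Y :\: free -> (g v \in X) /\ f (g v) v.
      rewrite !inE negb_and => /andP[+ vY]; rewrite vY /= negb_forall_in.
      move=> /existsP[w /andP[wX]]; rewrite negbK => fwv.
      by rewrite /g; case: pickP => [w' /andP[]//|/(_ w)]; rewrite wX fwv.
    have gI : {in Y :\: free &, injective g}.
      move=> v w vF wF gvw; have [_ fv] := gP v vF; have [_ fw] := gP w wF.
      move: vF wF => /setDP[vY _] /setDP[wY _].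
      by apply: (pairing_uniq fP cY vY wY fv); rewrite gvw.
    rewrite -(card_in_imset gI); apply/subset_leq_card/subsetP => w /imsetP[v vF ->].
    have [gX fg] := gP v vF; rewrite !inE gX andbT.
    by apply: contraTneq fg => ->; apply: noV; case/setDP: vF.
  have := cardsID free Y; have -> : Y :&: free = free.
    by apply/setIidPr/subsetP => v; rewrite inE => /andP[].
  by move: cu; have := cardsD1 u X; rewrite uX; lia.
pose N := [set v in Y | e x1 v].
have conflict v : v \in free -> (exists2 c, c \in X & f u c && e c v) \/
    (exists2 c, c \in Y & f c v && e u c).
  rewrite inE => /andP[vY /forall_inP vF].
  have uv : u != v by apply: contraTneq vY => <-; rewrite cov uX.
  have [c /orP[/andP[fc ec]|/andP[fc ec]]] := fm u v uv (noV v vY).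
    left; exists c; last by rewrite fc eC.
    by apply: contraTT fc => cX'; apply: noV; rewrite cov.
  right; exists c; last by rewrite fC fc.
  by rewrite cov; apply: contraL fc => /vF; rewrite fC.
(* The partners within [Y] of the vertices of [A]; the matching on [Y] bounds their number by
   [#|A|]. *)
pose Q (A : {set V}) := [set v in Y | [exists c in Y, (c \in A) && f c v]].
have card_Q A : #|Q A| <= #|A|.
  pose g v := odflt x1 [pick c in Y | (c \in A) && f c v].
  have gP v : v \in Q A -> g v \in A /\ f (g v) v.
    rewrite inE => /andP[vY /existsP[c /and3P[cY' cA fcv]]].
    by rewrite /g; case: pickP => [w /and3P[]//|/(_ c)]; rewrite cY' cA fcv.
  have gI : {in Q A &, injective g}.
    move=> v w vQ wQ gvw; have [_ fv] := gP v vQ; have [_ fw] := gP w wQ.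
    move: vQ wQ; rewrite !inE => /andP[vY _] /andP[wY _].
    by apply: (pairing_uniq fP cY vY wY fv); rewrite gvw.
  rewrite -(card_in_imset gI); apply/subset_leq_card/subsetP => w /imsetP[v vQ ->].
  by case: (gP v vQ).
have freeY v : v \in free -> v \in Y by rewrite inE => /andP[].
have inQ (A : {set V}) c v : v \in Y -> c \in Y -> c \in A -> f c v -> v \in Q A.
  move=> vY cY' cA fcv; rewrite inE vY; apply/existsP; exists c.
  by rewrite cY' cA.
have too_small (A B : {set V}) : #|A| + #|B| <= #|Y| - #|X| ->
    ~ {subset free <= A :|: B}.
  by move=> AB /subsetP/subset_leq_card; have := cardsUI A B; lia.
(* The cases differ in where [x1] can block: through its neighbours [N] as [u] itself, through [N]
   as the partner of [u], or not at all. The other blocked vertices are [y1] or its partner. *)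
have [ux|ux] := eqVneq u x1.
  apply: (too_small [set y1] (Q N)).
    by rewrite cards1; have := card_Q N; rewrite /N; lia.
  move=> v vF; rewrite in_setU in_set1.
  case: (conflict v vF) => -[c cA /andP[fc ec]].
    have := cross _ _ cA (freeY _ vF) ec; case/orP => [/eqP cx|->//].
    by move: fc; rewrite ux cx fI.
  have cN : c \in N by rewrite inE cA -ux.
  by rewrite (inQ N c v (freeY v vF) cA cN fc) orbT.
have [fux|fux] := boolP (f u x1).
  apply: (too_small N (Q [set y1])).
    by have := card_Q [set y1]; rewrite cards1 /N; lia.
  move=> v vF; rewrite in_setU.
  case: (conflict v vF) => -[c cA /andP[fc ec]].
    by rewrite inE freeY //= -(pairing_uniq fP cX cA hX fc fux) ec.
  have := cross _ _ uX cA ec; rewrite (negbTE ux) /= => /eqP cy.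
  by rewrite orbC (inQ _ c v (freeY v vF)) // cy set11.
apply: (too_small [set y1] (Q [set y1])).
  by have := card_Q [set y1]; rewrite cards1; lia.
move=> v vF; rewrite in_setU in_set1.
case: (conflict v vF) => -[c cA /andP[fc ec]].
  have := cross _ _ cA (freeY _ vF) ec; case/orP => [/eqP cx|->//].
  by move: fux; rewrite -cx fc.
have := cross _ _ uX cA ec; rewrite (negbTE ux) /= => /eqP cy.
by rewrite orbC (inQ _ c v (freeY v vF)) // cy set11.
Qed.

End MaximalPairing.

(** In each clique the number of unpaired vertices is odd and at most 2, hence 1. The ordered pairs
    then number [#|X| - 1] and [#|Y| - 1] inside the cliques and [2 * #|X|] across. *)
Lemma sum_maximal_pairing (V : finType) (e f : rel V) (X Y : {set V})
    (x1 y1 : V) (t : nat) :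
  symmetric e -> maximal_pairing e f -> two_cliques e X Y x1 y1 ->
  odd #|X| -> odd #|Y| -> #|X| < #|Y| ->
  #|[set v in Y | e x1 v]| <= t -> t < #|Y| - #|X| ->
  (\sum_u \sum_v f u v).+2 = 3 * #|X| + #|Y|.
Proof.
move=> eC fP cP oX oY XY card_t tn.
have [fC fI _ _] := fP; have [cov cX cY _ _ _ _] := cP.
have sumV (F : V -> nat) : \sum_u F u = \sum_(u in X) F u + \sum_(u in Y) F u.
  rewrite (bigID (mem X)) /=; congr (_ + _).
  by apply: eq_bigl => v; rewrite cov.
have XX := sum_pairing_unpaired fP cX; have YY := sum_pairing_unpaired fP cY.
have UX := card_unpaired_le2 fP cP.
have UY := card_unpaired_le2 fP (two_cliques_sym eC cP).
have pX := odd_sum_symmetric X fC fI; have pY := odd_sum_symmetric Y fC fI.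
have crossE : \sum_(u in X) \sum_(v in Y) f u v = #|X|.
  rewrite -sum1_card; apply: eq_bigr => u uX; rewrite (sum_pairing _ fP cY).
  (* Both sizes are odd, so their difference is at least 2. *)
  by rewrite (pairing_cross_exists eC fP cP card_t) //; lia.
have crossE' : \sum_(u in Y) \sum_(v in X) f u v = #|X|.
  rewrite exchange_big -[RHS]crossE /=.
  by apply: eq_bigr => u _; apply: eq_bigr => v _; rewrite fC.
under eq_bigr => u _ do rewrite sumV.
rewrite sumV !big_split /= crossE crossE'.
by lia.
Qed.

(** * Independent sets of the 2-token graph *)

Definition joined (G : sgraph) (F : {set token_graph 2 G}) : rel G :=
  fun u v => [exists p in F, val p == [set u; v]].

Lemma card2_set2 (T : finType) (A : {set T}) (u v : T) :
  #|A| = 2 -> (A == [set u; v]) = (u \in A) && (v \in A :\ u).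
Proof.
move=> A2; apply/eqP/andP => [eA|[uA]].
  move: A2; rewrite eA cards2; case: eqP => // /eqP uv _.
  by rewrite !inE !eqxx [v == u]eq_sym uv orbT.
rewrite !inE => /andP[vu vA]; apply/esym/eqP.
by rewrite eqEcard subUset !sub1set uA vA A2 cards2 eq_sym vu.
Qed.

(** Double counting: each member of [F] arises from two ordered pairs. *)
Lemma card_joined (G : sgraph) (F : {set token_graph 2 G}) :
  \sum_u \sum_v joined F u v = 2 * #|F|.
Proof.
have joinedE u v : joined F u v = \sum_(p in F) (val p == [set u; v]) :> nat.
  rewrite /joined; case: existsP => [[p /andP[pF /eqP pE]]|noP].
    rewrite (big_setD1 p pF) /= pE eqxx big1 // => q; rewrite !inE => /andP[qp _].
    by apply/eqP; rewrite eqb0 -pE; apply: contra qp => /eqP/val_inj ->.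
  rewrite big1 // => p pF; apply/eqP; rewrite eqb0; apply/negP => pE.
  by apply: noP; exists p; rewrite pF.
under eq_bigr => u _ do (under eq_bigr => v _ do rewrite joinedE);
  under eq_bigr => u _ do rewrite exchange_big.
rewrite exchange_big /= mulnC -sum_nat_const; apply: eq_bigr => p _.
have p2 : #|val p| = 2 by exact: (eqP (valP p)).
rewrite -[RHS]p2 -sum1_card [RHS]big_mkcond; apply: eq_bigr => u _.
under eq_bigr => v _ do rewrite (card2_set2 _ _ p2).
case: ifP => uP /=; last by rewrite big1.
have D1 : #|val p :\ u| = 1 by have := cardsD1 u (val p); rewrite uP p2 => -[].
by rewrite -[RHS]D1 -sum1_card [RHS]big_mkcond; apply: eq_bigr => v _; case: ifP.
Qed.

Lemma token_edge_share (G : sgraph) (p q : token_graph 2 G) (a b c : G) :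
  val p = [set a; b] -> val q = [set a; c] -> edge b c -> edge p q.
Proof.
move=> pE qE bc.
have [pc qc] : #|val p| == 2 /\ #|val q| == 2 by split; [exact: (valP p)|exact: (valP q)].
apply/existsP; exists b; apply/existsP; exists c; rewrite bc /=.
have ab : a != b by move: pc; rewrite pE cards2; case: (a == b).
have ac : a != c by move: qc; rewrite qE cards2; case: (a == c).
have cb : b != c by apply: contraTneq bc => ->; rewrite edge_irrefl.
apply/eqP/setP => v; rewrite /symdiff !(pE, qE, inE).
case: (eqVneq v a) => [->|_] /=; first by rewrite (negbTE ab) (negbTE ac).
by case: (eqVneq v b) => [->|_] /=; rewrite ?(negbTE cb) ?andbF.
Qed.

Lemma token_edgeP (G : sgraph) (p q : token_graph 2 G) :
  edge p q -> exists a b c, [/\ val p = [set a; b], val q = [set a; c] & edge b c].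
Proof.
move=> /existsP[u /existsP[v /andP[uv /eqP eD]]].
have [/eqP pc /eqP qc] : #|val p| == 2 /\ #|val q| == 2 by split; [exact: (valP p)|exact: (valP q)].
have uv' : u != v by apply: contraTneq uv => ->; rewrite edge_irrefl.
(* Both sets have two elements, so the two differences have equal size, namely 1, and one token is
   shared. *)
have D2 : #|val p :\: val q| + #|val q :\: val p| = 2.
  have := cards2 u v; rewrite uv' -eD /symdiff cardsU.
  suff -> : (val p :\: val q) :&: (val q :\: val p) = set0 by rewrite cards0 subn0.
  by apply/setP => w; rewrite !inE; case: (w \in val p); rewrite ?andbF.
have Ip := cardsID (val q) (val p); have Iq := cardsID (val p) (val q).
have IC : #|val q :&: val p| = #|val p :&: val q| by rewrite setIC.
have /eqP/cards1P[a aE] : #|val p :&: val q| = 1 by lia.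
have /eqP/cards1P[b bE] : #|val p :\: val q| = 1 by lia.
have /eqP/cards1P[c cE] : #|val q :\: val p| = 1 by lia.
exists a, b, c; split.
- by rewrite -aE -bE setID.
- by rewrite -aE -cE setIC setID.
move: eD; rewrite /symdiff bE cE => /setP eD.
have := eD u; have := eD v; have := eD b; have := eD c.
rewrite !inE !eqxx ?orbT /=.
move=> /esym/orP[/eqP->|/eqP->] /esym/orP[/eqP->|/eqP->] //.
- by rewrite orbb eq_sym (negbTE uv').
- by rewrite edge_sym.
- by rewrite !orbb (negbTE uv').
Qed.

Lemma joined_maximal (G : sgraph) (F : {set token_graph 2 G}) :
  maxset (@independent (token_graph 2 G)) F -> maximal_pairing edge (joined F).
Proof.
move=> /maxsetP[/forall_inP iF maxF]; split.
- by move=> u v; rewrite /joined setUC.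
- move=> u; apply/existsP => -[p /andP[_ /eqP pE]].
  by have := valP p; rewrite /= pE cards2 eqxx.
- move=> a b c /existsP[p /andP[pF /eqP pE]] /existsP[q /andP[qF /eqP qE]].
  apply/negP => bc; have /forall_inP/(_ _ qF) := iF _ pF.
  by rewrite (token_edge_share pE qE bc).
move=> a b ab nf.
have ab2 : #|[set a; b]| == 2 by rewrite cards2 ab.
pose p : token_graph 2 G := exist _ [set a; b] ab2.
have pF : p \notin F.
  by apply: contra nf => pF; apply/existsP; exists p; rewrite pF /=.
(* Otherwise [p |: F] would be a larger independent set. *)
have [q qF pq] : exists2 q, q \in F & edge p q.
  have [/existsP[q /andP[qF pq]]|] := boolP [exists q in F, edge p q].
    by exists q.
  rewrite negb_exists_in => /forall_inP noq; case/negP: pF.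
  rewrite -(maxF (p |: F)) ?setU11 ?subsetU1 //.
  apply/forall_inP => q; rewrite in_setU1 => /orP[/eqP->|qF];
    apply/forall_inP => r; rewrite in_setU1 => /orP[/eqP->|rF].
  - by rewrite edge_irrefl.
  - exact: noq.
  - by rewrite edge_sym noq.
  - by have /forall_inP/(_ _ rF) := iF _ qF.
have [d [u [c [pE qE uc]]]] := token_edgeP pq.
have fdc : joined F d c by apply/existsP; exists q; rewrite qF qE eqxx.
exists c; have := card2_set2 d u (eqP ab2); rewrite -[in LHS]pE eqxx !inE.
move=> /esym/andP[/orP[/eqP da|/eqP db] /andP[ud /orP[/eqP ua|/eqP ub]]].
- by move: ud; rewrite da ua eqxx.
- by rewrite -da -ub fdc uc.
- by rewrite -db -ua fdc uc orbT.
- by move: ud; rewrite db ub eqxx.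
Qed.

(** * Application to the graphs of the class *)

Theorem theorem6p11 (G : sgraph) (m n s t : nat) (x : 'I_m -> G) (y : 'I_n -> G)
  (hG : two_clique_graph x y)
  (hmn : m < n) (hm : odd m) (hn : odd n)
  (hs : s + 1 <= m) (ht : t + 1 <= n - m)
  (hx1 : forall i : 'I_m, i = 0 :> nat ->
    closed_nbhd (x i) = [set y j | j : 'I_n & 1 <= j <= t] :|: [set x k | k : 'I_m])
  (hy1 : forall j : 'I_n, j = 0 :> nat ->
    closed_nbhd (y j) = [set x i | i : 'I_m & 1 <= i <= s] :|: [set y k | k : 'I_n])
  (hx : forall i : 'I_m, s + 1 <= i -> closed_nbhd (x i) = [set x k | k : 'I_m])
  (hy : forall j : 'I_n, t + 1 <= j -> closed_nbhd (y j) = [set y k | k : 'I_n])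
  (hxy : forall (i : 'I_m) (j : 'I_n), 0 < i -> 0 < j -> ~~ edge (x i) (y j)) :
  well_covered (token_graph 2 G).
Proof.
have [_ injx injy disj cover cliqx cliqy] := hG.
have m0 : 0 < m by lia.
have n0 : 0 < n by lia.
pose i0 := Ordinal m0; pose j0 := Ordinal n0.
pose X := [set x k | k : 'I_m]; pose Y := [set y k | k : 'I_n].
have xX i : x i \in X by apply: imset_f.
have yY j : y j \in Y by apply: imset_f.
have yX j : y j \notin X.
  by apply/imsetP => -[i _ /eqP]; rewrite eq_sym (negbTE (disj _ _)).
have xY i : x i \notin Y.
  by apply/imsetP => -[j _ /eqP]; rewrite (negbTE (disj _ _)).
have cardX : #|X| = m by rewrite card_imset // card_ord.
have cardY : #|Y| = n by rewrite card_imset // card_ord.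
(* This bounds the neighbours of the hub [x i0] in [Y] by [t], and its lower bound 1 makes the two
   hubs nonadjacent. *)
have nbhd1 j : edge (x i0) (y j) -> 1 <= j <= t.
  move=> ej; have : y j \in closed_nbhd (x i0) by rewrite inE ej orbT.
  rewrite hx1 // in_setU (negbTE (yX j)) orbF => /imsetP[k].
  by rewrite inE => kt /injy ->.
have cP : two_cliques edge X Y (x i0) (y j0).
  split=> //.
  - by move=> v; case: (cover v) => -[i ->]; rewrite ?yX ?yY ?xX ?(negbTE (xY _)).
  - move=> u v /imsetP[i _ ->] /imsetP[k _ ->] ik; apply: cliqx.
    by apply: contraNneq ik => ->.
  - move=> u v /imsetP[i _ ->] /imsetP[k _ ->] ik; apply: cliqy.
    by apply: contraNneq ik => ->.
  - by apply/negP => /nbhd1.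
  move=> u v /imsetP[i _ ->] /imsetP[j _ ->]; apply: contraTT.
  rewrite negb_or => /andP[ii0 jj0]; apply: hxy; rewrite lt0n.
    by apply: contraNneq ii0 => i_0; apply/eqP; congr x; apply: val_inj.
  by apply: contraNneq jj0 => j_0; apply/eqP; congr y; apply: val_inj.
have card_t : #|[set v in Y | edge (x i0) v]| <= t.
  apply: leq_trans (card_ord_range n t); rewrite -(card_imset _ injy).
  apply/subset_leq_card/subsetP => v; rewrite inE => /andP[/imsetP[j _ ->] /nbhd1 jt].
  by apply: imset_f; rewrite inE.
suff cardF (F : {set token_graph 2 G}) : maxset (@independent _) F ->
    (2 * #|F|).+2 = 3 * m + n.
  by move=> A B /cardF cA /cardF cB; lia.
move=> /joined_maximal fP; rewrite -card_joined.
by rewrite (sum_maximal_pairing (@edge_sym G) fP cP _ _ _ card_t) ?cardX ?cardY //; lia.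
Qed.
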